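(* Let $n\geq 1$ be an integer and consider a one-dimensional system of $n+1$ elastic hard balls, numbered $0,1,\dots,n$ in the order of increasing coordinates, with masses $m_0,m_1,\dots,m_n>0$ and radii $r_0,\dots,r_n\geq 0$, moving freely on a line and interacting only through elastic binary collisions of adjacent balls. If $$m_i\geq\sqrt{m_{i-1}m_{i+1}}\qquad\text{for all } i=1,\dots,n-1,$$ then the maximum number of collisions is $\frac{n(n+1)}{2}$. That is, for these masses and radii, for every admissible initial condition (one for which no multiple collision ever occurs) the total number of collisions during the motion is at most $\frac{n(n+1)}{2}$, and there exists an admissible initial condition for which the total number of collisions equals $\frac{n(n+1)}{2}$.
   Context: The system: ball $i$ ($0\leq i\leq n$) has mass $m_i>0$, radius $r_i\geq 0$ (radius $0$ means a point particle), center at $x_i(t)\in\mathbb{R}$ and velocity $v_i(t)$. An initial condition at time $t=0$ consists of positions with $x_i(0)-x_{i-1}(0)>r_{i-1}+r_i$ for $1\leq i\leq n$ and arbitrary real velocities $v_0(0),\dots,v_n(0)$. The balls never pass through each other: $x_i(t)-x_{i-1}(t)\geq r_{i-1}+r_i$ for all $t\ge 0$ and $1\leq i\leq n$, so their order on the line is preserved. Motion: the positions are continuous in time, and between collisions every ball moves with constant velocity. A collision between balls $i-1$ and $i$ ($1\leq i\leq n$) occurs at a time $t$ when they come into contact, i.e. $x_i(t)-x_{i-1}(t)=r_{i-1}+r_i$; their velocities immediately before it satisfy $v_{i-1}>v_i$. In the collision the velocities of these two balls change according to conservation of momentum and energy to $$v'_{i-1}=\frac{(m_{i-1}-m_i)v_{i-1}+2m_iv_i}{m_{i-1}+m_i},\qquad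 v'_i=\frac{2m_{i-1}v_{i-1}+(m_i-m_{i-1})v_i}{m_{i-1}+m_i},$$ and the velocities of balls not involved in a collision are unchanged. The collision times form a locally finite subset of $[0,\infty)$. Multiple collisions: a multiple collision is a time $t$ at which, for some $1\le i\le n-1$, ball $i$ is in contact with both ball $i-1$ and ball $i+1$. The motion is not defined past such a time, and it is assumed that multiple collisions do not occur. An initial condition is called admissible if the motion it generates for $t\geq 0$ never has a multiple collision. Several binary collisions between disjoint pairs of adjacent balls may happen at the same time; each such pair counts as one collision. The number of collisions of a motion is the total number of pairs $(t,i)$ with $t\geq 0$ and $1\leq i\leq n$ such that balls $i-1$ and $i$ collide at time $t$. *)

(* Defs.v *)
From mathcomp Require Import all_boot all_order all_algebra.
From mathcomp Require Import all_classical all_reals all_analysis.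

Set Implicit Arguments.
Unset Strict Implicit.
Unset Printing Implicit Defensive.

Import Order.TTheory GRing.Theory Num.Theory.
Import numFieldNormedType.Exports.

Local Open Scope classical_set_scope.
Local Open Scope ring_scope.

(* The n+1 balls are indexed by 'I_n.+1 and the n pairs of adjacent balls by
   'I_n: the pair i consists of the balls i (lball i) and i+1 (rball i). *)
Definition lball (n : nat) (i : 'I_n) : 'I_n.+1 := widen_ord (leqnSn n) i.
Definition rball (n : nat) (i : 'I_n) : 'I_n.+1 := lift ord0 i.

(* Velocities jump at collisions, so both one-sided values are recorded:
   vpre k t just before time t, vpost k t just after.  All three functions are
   total on R; only the times t >= 0 (t > 0 for vpre) are meaningful. *)
Record trajectory (R : realType) (n : nat) := Trajectory {
  pos : 'I_n.+1 -> R -> R;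
  vpre : 'I_n.+1 -> R -> R;
  vpost : 'I_n.+1 -> R -> R }.

Definition initial_positions (R : realType) (n : nat) (r x0 : 'I_n.+1 -> R) : Prop :=
  forall i : 'I_n, r (lball i) + r (rball i) < x0 (rball i) - x0 (lball i).

Definition contact (R : realType) (n : nat) (r : 'I_n.+1 -> R)
    (X : trajectory R n) (t : R) (i : 'I_n) : Prop :=
  pos X (rball i) t - pos X (lball i) t = r (lball i) + r (rball i).

Definition collisions (R : realType) (n : nat) (r : 'I_n.+1 -> R)
    (X : trajectory R n) : set (R * 'I_n) :=
  [set p | 0 <= p.1 /\ contact r X p.1 p.2].

Definition collision_times (R : realType) (n : nat) (r : 'I_n.+1 -> R)
    (X : trajectory R n) : set R :=
  [set t | 0 <= t /\ exists i : 'I_n, contact r X t i].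

Definition multiple_collision (R : realType) (n : nat) (r : 'I_n.+1 -> R)
    (X : trajectory R n) (t : R) : Prop :=
  exists i j : 'I_n, [/\ lball j = rball i, contact r X t i & contact r X t j].

(* Motion on the whole half-line [0, +oo[.  Since a motion is not defined past
   a multiple collision, such a motion has none. *)
Record motion (R : realType) (n : nat) (m r x0 v0 : 'I_n.+1 -> R)
    (X : trajectory R n) : Prop := Motion {
  motion_pos0 : forall k, pos X k 0 = x0 k;
  motion_vel0 : forall k, vpost X k 0 = v0 k;
  motion_continuous : forall k, {within `[0, +oo[, continuous (pos X k)};
  motion_order : forall t (i : 'I_n), 0 <= t ->
    r (lball i) + r (rball i) <= pos X (rball i) t - pos X (lball i) t;
  motion_locally_finite : forall T : R,
    finite_set (collision_times r X `&` `[0, T]);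
  motion_free : forall s t : R, 0 <= s -> s < t ->
    (forall u, s < u < t -> ~ collision_times r X u) ->
    forall k, vpre X k t = vpost X k s /\
      forall u, s <= u <= t -> pos X k u = pos X k s + vpost X k s * (u - s);
  motion_collision : forall t (i : 'I_n), 0 <= t -> contact r X t i ->
    let a := lball i in let b := rball i in
    [/\ vpre X b t < vpre X a t,
        vpost X a t = ((m a - m b) * vpre X a t + 2 * m b * vpre X b t)
                      / (m a + m b) &
        vpost X b t = (2 * m a * vpre X a t + (m b - m a) * vpre X b t)
                      / (m a + m b)];
  motion_unaffected : forall t (k : 'I_n.+1), 0 < t ->
    (forall i : 'I_n, k = lball i \/ k = rball i -> ~ contact r X t i) ->
    vpost X k t = vpre X k t;
  motion_no_multiple : forall t, 0 <= t -> ~ multiple_collision r X t }.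

Definition admissible (R : realType) (n : nat) (m r x0 v0 : 'I_n.+1 -> R) : Prop :=
  initial_positions r x0 /\ exists X : trajectory R n, motion m r x0 v0 X.

(* Main.v *)
Require Import Defs.
From mathcomp Require Import all_boot all_order all_algebra.
From mathcomp Require Import all_classical all_reals all_analysis.
From mathcomp Require Import fingroup perm finmap.
From mathcomp Require Import ring lra zify.

Import Order.TTheory GRing.Theory Num.Theory.
Import numFieldNormedType.Exports.

Set Implicit Arguments.
Unset Strict Implicit.
Unset Printing Implicit Defensive.

Local Open Scope classical_set_scope.
Local Open Scope card_scope.
Local Open Scope ring_scope.

(* Upper bound.  Divide the velocity differences of adjacent balls by suitable
   constants ([pair_scale]) and let V be the vector of partial sums
   ([scaled_vel]).  Log-concavity of the masses makes a collision act on V as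
   the exchange of two adjacent entries followed by the addition of a vector
   that is nondecreasing along the line.  Let labels travel with the exchanged
   entries: once two labels have crossed, the right one has the larger entry
   for ever, whereas a collision needs the left entry to be the larger one.  So
   each of the n(n+1)/2 pairs of labels crosses at most once.

   Sharpness, by induction on n: let the first n balls make their n(n-1)/2
   collisions while the last ball is far away, then let it arrive so fast that
   the blow is passed on to the leftmost ball, which costs n more collisions.
   Log-concavity ensures that these come one after the other. *)

(** * Scaled velocity differences under collisions *)

(** [S] holds the left indices of the pairs that collide at one instant. If it contains no two
    consecutive indices, this is the product of the disjoint transpositions of [p] and [p.+1] for
    [p] in [S]. *)
Definition swaps (S : pred nat) (p : nat) : nat :=
  if S p then p.+1 else if (0 < p)%N && S p.-1 then p.-1 else p.

(** The factors make a collision of pair [j] add its scaled velocity difference, without any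
    coefficient, to that of pair [j.+1]. *)
Definition pair_scale {R : realType} (m : nat -> R) (j : nat) : R :=
  \prod_(i < j) (2 * m i / (m i + m i.+1)).

Definition scaled_vel {R : realType} (m v : nat -> R) (p : nat) : R :=
  \sum_(j < p) (v j.+1 - v j) / pair_scale m j.

Lemma scaled_velS {R : realType} (m v : nat -> R) p :
  scaled_vel m v p.+1 = scaled_vel m v p + (v p.+1 - v p) / pair_scale m p.
Proof. by rewrite /scaled_vel big_ord_recr. Qed.

Lemma pair_scaleS {R : realType} (m : nat -> R) j :
  pair_scale m j.+1 = pair_scale m j * (2 * m j / (m j + m j.+1)).
Proof. by rewrite /pair_scale big_ord_recr. Qed.

Lemma pair_scale_gt0 {R : realType} (m : nat -> R) n j :
  (forall k, (k <= n)%N -> 0 < m k) -> (j <= n)%N -> 0 < pair_scale m j.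
Proof.
move=> m0 jn; apply: prodr_gt0 => -[i /= ij] _.
have m1 := m0 i ltac:(lia); have m2 := m0 i.+1 ltac:(lia).
by rewrite divr_gt0 ?mulr_gt0 ?addr_gt0.
Qed.

Lemma swapsK (S : pred nat) p : (forall j, S j -> ~~ S j.+1) -> swaps S (swaps S p) = p.
Proof.
move=> S1; rewrite /swaps; case Sp: (S p) => /=.
  by rewrite (negbTE (S1 _ Sp)) Sp.
case: p Sp => [|p] /= Sp; first by rewrite Sp.
case Sp': (S p) => /=; first by rewrite Sp'.
by rewrite Sp Sp'.
Qed.

Lemma swaps_lt (S : pred nat) p q : (forall j, S j -> ~~ S j.+1) ->
  (p < q)%N -> (swaps S q < swaps S p)%N -> S p /\ q = p.+1.
Proof.
move=> S1 pq; rewrite /swaps; case Sp: (S p) => /=.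
  case Sq: (S q); first lia.
  have [|] := boolP ((0 < q)%N && S q.-1); last lia.
  move=> /andP[q0 Sq1]; have [->|?] := eqVneq q p.+1; first by [].
  have [qE|?] := eqVneq q.-1 p.+1; last lia.
  by move: (S1 _ Sp); rewrite -qE Sq1.
case Sq: (S q); first by case: ifP; lia.
have [/andP[q0 Sq1]|?] := boolP ((0 < q)%N && S q.-1); last by case: ifP; lia.
have [qE|?] := eqVneq q p.+1; last by case: ifP; lia.
by move: Sq1; rewrite qE /= Sp.
Qed.

(** Let d_p be the scaled velocity difference of pair p. If pair p collides, d_p changes sign and
    equality holds. Otherwise a collision of pair p-1 adds exactly d_(p-1), while one of pair p+1
    adds d_(p+1) times 4 m_p m_(p+2) / ((m_p + m_(p+1)) (m_(p+1) + m_(p+2))). This factor is at most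
    1 and d_(p+1) is negative, so at least d_(p+1) is added. *)
Lemma scaled_vel_collide_step {R : realType} n (m v v' : nat -> R) (S : pred nat) :
  (forall k, (k <= n)%N -> 0 < m k) ->
  (forall j, (j.+2 <= n)%N ->
     4 * (m j * m j.+2) <= (m j + m j.+1) * (m j.+1 + m j.+2)) ->
  (forall j, S j -> (j < n)%N) -> (forall j, S j -> ~~ S j.+1) ->
  (forall j, S j -> v j.+1 < v j) ->
  (forall j, S j ->
     v' j = ((m j - m j.+1) * v j + 2 * m j.+1 * v j.+1) / (m j + m j.+1) /\
     v' j.+1 = (2 * m j * v j + (m j.+1 - m j) * v j.+1) / (m j + m j.+1)) ->
  (forall k, (k <= n)%N -> ~~ S k -> ~~ ((0 < k)%N && S k.-1) -> v' k = v k) ->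
  forall p, (p < n)%N ->
  scaled_vel m v (swaps S p.+1) - scaled_vel m v (swaps S p)
    <= scaled_vel m v' p.+1 - scaled_vel m v' p.
Proof.
move=> m0 mc Sn S1 Sv Sc Su p pn.
have c0 j : (j <= n)%N -> 0 < pair_scale m j by exact: pair_scale_gt0.
have mp := m0 p (ltnW pn); have mp1 := m0 _ pn.
rewrite [in leRHS]scaled_velS addrAC subrr add0r.
rewrite /swaps /=; case Sp: (S p).
  rewrite (negbTE (S1 _ Sp)) scaled_velS opprD addrA subrr add0r.
  have [-> ->] := Sc _ Sp.
  rewrite -mulNr ler_pM2r ?invr_gt0 ?c0 ?(ltnW pn)// le_eqVlt; apply/orP; left.
  by apply/eqP; field; lra.
have cp := c0 p (ltnW pn).
have -> : scaled_vel m v (if S p.+1 then p.+2 else p.+1) = scaled_vel m v p.+1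
    + (if S p.+1 then (v p.+2 - v p.+1) / pair_scale m p.+1 else 0).
  by case: ifP; rewrite ?addr0// scaled_velS.
have -> : scaled_vel m v (if (0 < p)%N && S p.-1 then p.-1 else p) =
    scaled_vel m v p
    - (if (0 < p)%N && S p.-1 then (v p - v p.-1) / pair_scale m p.-1 else 0).
  by case: p {Sp cp mp mp1 pn} => [|p]; rewrite ?subr0//=; case: ifP;
     rewrite ?subr0// scaled_velS addrK.
have -> : v' p = v p - pair_scale m p *
    (if (0 < p)%N && S p.-1 then (v p - v p.-1) / pair_scale m p.-1 else 0).
  case: ifPn => [/andP[p0 Sp1]|Sp1]; last by rewrite mulr0 subr0 Su ?Sp// ltnW.
  case: p p0 Sp1 pn cp mp {mp1 Sp} => //= p _ Sp pn cp1 mp1; have [_ ->] := Sc _ Sp.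
  have mp := m0 p ltac:(lia); have cp := c0 p ltac:(lia).
  by rewrite pair_scaleS; field; lra.
(* The contribution from the right is only bounded: dividing by the negative [v p.+2 - v p.+1] turns
   the claim into [mc]. *)
have : pair_scale m p * (if S p.+1 then (v p.+2 - v p.+1) / pair_scale m p.+1 else 0)
   <= v' p.+1 - v p.+1.
  case: ifPn => Sp1; last by rewrite mulr0 Su ?subrr//= Sp.
  have [-> _] := Sc _ Sp1; have mp2 := m0 _ (Sn _ Sp1).
  have -> : ((m p.+1 - m p.+2) * v p.+1 + 2 * m p.+2 * v p.+2) / (m p.+1 + m p.+2)
     - v p.+1 = (v p.+2 - v p.+1) * (2 * m p.+2 / (m p.+1 + m p.+2)).
    by field; lra.
  rewrite mulrCA ler_nM2l ?subr_lt0 ?Sv// pair_scaleS invfM mulrA divff ?mul1r ?gt_eqF//.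
  rewrite invf_div ler_pdivrMr ?addr_gt0// mulrAC ler_pdivlMr ?mulr_gt0//.
  have := mc p (Sn _ Sp1); lra.
rewrite scaled_velS => H.
set X := (if S p.+1 then _ else _) in H *; set Y := (if _ then _ else _).
set V := scaled_vel m v p.
rewrite -(ler_pM2l cp).
have -> : pair_scale m p * (V + (v p.+1 - v p) / pair_scale m p + X - (V - Y)) =
  v p.+1 - v p + pair_scale m p * X + pair_scale m p * Y by field; lra.
by rewrite [leRHS]mulrC divfK ?gt_eqF//; lra.
Qed.

Lemma scaled_vel_collide {R : realType} n (m v v' : nat -> R) (S : pred nat) :
  (forall k, (k <= n)%N -> 0 < m k) ->
  (forall j, (j.+2 <= n)%N ->
     4 * (m j * m j.+2) <= (m j + m j.+1) * (m j.+1 + m j.+2)) ->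
  (forall j, S j -> (j < n)%N) -> (forall j, S j -> ~~ S j.+1) ->
  (forall j, S j -> v j.+1 < v j) ->
  (forall j, S j ->
     v' j = ((m j - m j.+1) * v j + 2 * m j.+1 * v j.+1) / (m j + m j.+1) /\
     v' j.+1 = (2 * m j * v j + (m j.+1 - m j) * v j.+1) / (m j + m j.+1)) ->
  (forall k, (k <= n)%N -> ~~ S k -> ~~ ((0 < k)%N && S k.-1) -> v' k = v k) ->
  forall p q, (p <= q <= n)%N ->
  scaled_vel m v (swaps S q) - scaled_vel m v (swaps S p)
    <= scaled_vel m v' q - scaled_vel m v' p.
Proof.
move=> m0 mc Sn S1 Sv Sc Su p q /andP[]; elim: q => [|q IHq].
  by rewrite leqn0 => /eqP ->; rewrite !subrr.
rewrite leq_eqVlt => /orP[/eqP -> _|pq qn]; first by rewrite !subrr.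
have := scaled_vel_collide_step m0 mc Sn S1 Sv Sc Su qn.
by have := IHq pq (ltnW qn); lra.
Qed.

(** * Labels and their crossings *)

(* [rho] gives the position of each label; labels travel along with the
   velocities exchanged in collisions. *)
Definition crossed {n : nat} (rho : {perm 'I_n.+1}) : {set 'I_n.+1 * 'I_n.+1} :=
  [set ab : 'I_n.+1 * 'I_n.+1 | (ab.1 < ab.2)%N && (rho ab.2 < rho ab.1)%N]%SET.

Lemma widen_inj m n (mn : (m <= n)%N) : injective (widen_ord mn).
Proof. by move=> x y /(congr1 val) /= xy; apply: val_inj. Qed.

Lemma card_crossed n (rho : {perm 'I_n.+1}) : (#|crossed rho| <= (n * n.+1) %/ 2)%N.
Proof.
apply: (@leq_trans #|[set ab : 'I_n.+1 * 'I_n.+1 | (ab.1 < ab.2)%N]%SET|).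
  by apply: subset_leq_card; apply/fintype.subsetP => ab; rewrite !inE => /andP[].
rewrite -sum1dep_card -(pair_big_dep xpredT (fun a b : 'I_n.+1 => (a < b)%N) (fun _ _ => 1%N)) /=.
rewrite (exchange_big_dep xpredT) //=.
under eq_bigr => j _.
  rewrite sum1dep_card.
  have -> : #|[set x : 'I_n.+1 | (x < j)%N]%SET| = j.
    rewrite -[RHS]card_ord -(card_imset _ (@widen_inj _ _ (ltnW (ltn_ord j)))).
    apply: eq_card => x; rewrite !inE; apply/idP/imsetP => [xj|[y _ ->]] /=.
      by exists (Ordinal xj) => //; exact: val_inj.
    by [].
  over.
by rewrite -(big_mkord xpredT id) /= bin2_sum bin2 mulnC divn2.
Qed.

Definition crossed_separating {R : realType} {n : nat} (V : nat -> R)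
    (rho : {perm 'I_n.+1}) : Prop :=
  forall a b : 'I_n.+1, (a < b)%N -> (rho b < rho a)%N -> V (rho b) < V (rho a).

Lemma swaps_le n (S : pred nat) p :
  (forall j, S j -> (j < n)%N) -> (p <= n)%N -> (swaps S p <= n)%N.
Proof. by move=> Sn pn; rewrite /swaps; case: ifP => [/Sn//|_]; case: ifP; lia. Qed.

Lemma swaps_left (S : pred nat) p : S p -> swaps S p = p.+1.
Proof. by rewrite /swaps => ->. Qed.

Lemma swaps_right (S : pred nat) p :
  (forall j, S j -> ~~ S j.+1) -> S p -> swaps S p.+1 = p.
Proof. by move=> S1 Sp; rewrite /swaps (negbTE (S1 _ Sp)) Sp. Qed.

(** The new labelling is [rho] followed by [swaps S]. Two colliding positions carry labels that have
    not crossed yet, since the larger entry is on the left; they cross now. No earlier crossing is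
    undone, because [swaps S] reverses only colliding positions. *)
Lemma crossed_collide {R : realType} n (V V' : nat -> R) (S : pred nat)
    (rho : {perm 'I_n.+1}) :
  (forall j, S j -> (j < n)%N) -> (forall j, S j -> ~~ S j.+1) ->
  (forall j, S j -> V j.+1 < V j) ->
  (forall p q, (p <= q <= n)%N ->
     V (swaps S q) - V (swaps S p) <= V' q - V' p) ->
  crossed_separating V rho ->
  exists rho' : {perm 'I_n.+1}, crossed_separating V' rho' /\
    (#|crossed rho| + #|[set i : 'I_n | S i]%SET| <= #|crossed rho'|)%N.
Proof.
move=> Sn S1 SV VV' Vrho.
pose f (p : 'I_n.+1) : 'I_n.+1 := inord (swaps S p).
have fE p : f p = swaps S p :> nat by rewrite inordK// ltnS swaps_le// -ltnS.
have finj : injective f.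
  move=> p q /(congr1 (@nat_of_ord _)); rewrite !fE => /(congr1 (swaps S)).
  by rewrite !swapsK// => /val_inj.
exists (rho * perm finj)%g.
have rE a : (rho * perm finj)%g a = swaps S (rho a) :> nat by rewrite permM permE fE.
split.
  move=> a b ab; rewrite !rE => rba.
  (* Either the labels had crossed before, or by [swaps_lt] they cross in this very collision. *)
  have : V (rho b) < V (rho a).
    have [rab|] := ltnP (rho b) (rho a); first exact: Vrho.
    rewrite leq_eqVlt => /orP[/eqP rab|rab]; first by rewrite rab ltnn in rba.
    by have [Sa ->] := swaps_lt S1 rab rba; exact: SV.
  have /VV' : (swaps S (rho b) <= swaps S (rho a) <= n)%N.
    by rewrite ltnW//= swaps_le// -ltnS.
  by rewrite !swapsK//; lra.
pose g (i : 'I_n) := ((rho^-1)%g (lball i), (rho^-1)%g (rball i)).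
have ginj : injective g.
  by move=> i j [/perm_inj /(congr1 val) /= ij _]; exact: val_inj.
rewrite -(card_imset _ ginj) -cardsUI.
have -> : crossed rho :&: [set g x | x in [set i : 'I_n | S i]%SET]%SET = finset.set0.
  apply/setP => -[a b]; rewrite !inE /=; apply/negP => /andP[/andP[_ +]].
  by move=> + /imsetP[i _ [ea eb]]; rewrite ea eb !permKV /= /bump /=; lia.
rewrite cards0 addn0 subset_leq_card//; apply/fintype.subsetP => -[a b].
rewrite !inE /= !rE => /orP[/andP[ab rba]|/imsetP[i]].
  rewrite ab /= ltnNge; apply/negP; rewrite leq_eqVlt => /orP[/eqP /(congr1 (swaps S))|].
    by rewrite !swapsK//; lia.
  move=> /(swaps_lt S1 rba)[Sb rE'].
  by have := Vrho _ _ ab rba; rewrite rE' => /lt_trans/(_ (SV _ Sb)); rewrite ltxx.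
rewrite inE => Si [-> ->]; rewrite !permKV /=.
have -> : bump 0 i = i.+1 by [].
apply/andP; split; last first.
  by rewrite (swaps_left Si) (swaps_right S1 Si).
(* The left label is the smaller one: otherwise the two have already crossed, and [Vrho] contradicts
   [SV]. *)
rewrite ltnNge leq_eqVlt; apply/negP => /orP[/eqP/val_inj/perm_inj/(congr1 val)|].
  by move=> /=; rewrite /bump /=; lia.
move=> /Vrho; rewrite !permKV /= => /(_ (ltnSn _)).
by move=> /lt_trans/(_ (SV _ Si)); rewrite ltxx.
Qed.

(** * Counting by finite subsets, the mass inequality, indexing by [nat] *)

(** An infinite set has finite subsets of every size, so the bound forces finiteness. Thus a bound
    valid up to each time passes to the whole half-line. *)
Lemma card_le_fset (T : choiceType) (A : set T) N :
  (forall B : {fset T}, [set` B] `<=` A -> (#|` B| <= N)%N) -> A #<= `I_N.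
Proof.
move=> AN; have [/finite_setP[k Ak]|/(infinite_set_fset N.+1)[B BA]] := pselect (finite_set A).
  rewrite (card_le_eql Ak) card_le_II.
  have fA : finite_set A by apply/finite_setP; exists k.
  by rewrite -(card_fset_set Ak); apply: AN; rewrite fset_setK.
by have := AN _ BA; lia.
Qed.

(** Expand the right side as b(a + c) + b^2 + ac: here b^2 >= ac, and b(a + c) >= 2ac by the
    inequality of arithmetic and geometric means. Log-concavity enters both halves of the proof in
    this form only. *)
Lemma logconcave_mass_ineq {R : realType} (a b c : R) :
  0 < a -> 0 < b -> 0 < c -> Num.sqrt (a * c) <= b ->
  4 * (a * c) <= (a + b) * (b + c).
Proof.
move=> a0 b0 c0 sb; set s := Num.sqrt (a * c) in sb.
have s0 : 0 <= s by exact: sqrtr_ge0.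
have sE : s ^+ 2 = a * c by rewrite sqr_sqrtr// mulr_ge0// ltW.
have sac : 2 * s <= a + c.
  have s2 : 0 <= 2 * s by rewrite mulr_ge0.
  have ac : 0 <= a + c by rewrite addr_ge0 ?ltW.
  rewrite -(@ler_pXn2r _ 2)// (_ : (2 * s) ^+ 2 = 4 * (a * c)); last by rewrite -sE; ring.
  by rewrite -subr_ge0 (_ : _ - _ = (a - c) ^+ 2) ?sqr_ge0//; ring.
have : s * (2 * s) <= b * (a + c) by rewrite ler_pM ?mulr_ge0.
have : s * s <= b * b by rewrite ler_pM.
by rewrite -sE; lra.
Qed.

(** Out of range [inord] still yields some ball, so positivity of the masses holds at every [k]. *)
Definition nat_ext {R : realType} {n : nat} (f : 'I_n.+1 -> R) (k : nat) : R :=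
  f (inord k).

Lemma nat_ext_val {R : realType} n (f : 'I_n.+1 -> R) (k : 'I_n.+1) :
  nat_ext f k = f k.
Proof. by rewrite /nat_ext inord_val. Qed.

Lemma logconcave_nat_ext {R : realType} n (m : 'I_n.+1 -> R) :
  (forall k, 0 < m k) ->
  (forall h i j : 'I_n.+1,
     i = h.+1 :> nat -> j = i.+1 :> nat -> Num.sqrt (m h * m j) <= m i) ->
  forall j, (j.+2 <= n)%N -> 4 * (nat_ext m j * nat_ext m j.+2) <=
    (nat_ext m j + nat_ext m j.+1) * (nat_ext m j.+1 + nat_ext m j.+2).
Proof.
move=> m_gt0 mlc j jn; apply: logconcave_mass_ineq; try exact: m_gt0.
by apply: mlc; rewrite !inordK; lia.
Qed.

Lemma lball_inord n (i : 'I_n) : lball i = inord i.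
Proof. by apply: val_inj; rewrite /= inordK ?ltnS ?(ltnW (ltn_ord i)). Qed.

Lemma rball_inord n (i : 'I_n) : rball i = inord i.+1.
Proof. by apply: val_inj; rewrite /= inordK ?ltnS. Qed.

Lemma ex_max_seq (R : realType) (x : R) (s : seq R) :
  exists2 y, y \in x :: s & forall z, z \in x :: s -> z <= y.
Proof.
elim: s x => [|a s IHs] x; first by exists x; rewrite ?mem_head// => z; rewrite inE => /eqP->.
have [y ys ymax] := IHs a; have [yx|xy] := leP y x.
  exists x; first exact: mem_head.
  by move=> z; rewrite inE => /orP[/eqP->//|/ymax zy]; exact: le_trans yx.
exists y; first by rewrite inE ys orbT.
by move=> z; rewrite inE => /orP[/eqP->|/ymax//]; exact: ltW.
Qed.

(** * The upper bound, following a motion through its collision times *)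

Section upper_bound.
Context {R : realType} {n : nat}.
Variables (m r x0 v0 : 'I_n.+1 -> R) (X : trajectory R n).
Hypothesis m_gt0 : forall k, 0 < m k.
Hypothesis m_logconcave : forall h i j : 'I_n.+1,
  i = h.+1 :> nat -> j = i.+1 :> nat -> Num.sqrt (m h * m j) <= m i.
Hypothesis x0_apart : initial_positions r x0.
Hypothesis motionX : motion m r x0 v0 X.

(** The invariant carried along the motion. A covering list replaces an exact count, so that
    finiteness of the set of collisions need not be known. *)
Definition bounded_by_crossings (t : R) : Prop :=
  exists rho : {perm 'I_n.+1},
    crossed_separating
      (scaled_vel (nat_ext m) (nat_ext (fun k => vpost X k t))) rho /\
    exists s : seq (R * 'I_n), (size s <= #|crossed rho|)%N /\
      forall p, collisions r X p -> p.1 <= t -> p \in s.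

Lemma no_contact0 i : ~ contact r X 0 i.
Proof.
by rewrite /contact !(motion_pos0 motionX); have := x0_apart i => + h; rewrite h ltxx.
Qed.

Lemma bounded_by_crossings0 : bounded_by_crossings 0.
Proof.
exists 1%g; split; first by move=> a b; rewrite !perm1; lia.
exists [::]; split=> // -[t i] /= [/= t0 ci] t0'.
have te : t = 0 by apply/eqP; rewrite eq_le t0' t0.
by case: (@no_contact0 i); rewrite -te.
Qed.

(** The velocities just before [t] are those just after [s], so all collisions at [t] together form
    one application of [crossed_collide]. *)
Lemma bounded_by_crossings_step s t : 0 <= s -> s < t ->
  (forall u, s < u < t -> ~ collision_times r X u) ->
  bounded_by_crossings s -> bounded_by_crossings t.
Proof.
move=> s0 st free [rho [Vrho [l [lrho lP]]]].
have t0 : 0 <= t by rewrite (le_trans s0)// ltW.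
pose S : pred nat := fun j => `[< exists2 i : 'I_n, val i = j & contact r X t i >].
have SP (i : 'I_n) : S i <-> contact r X t i.
  split=> [/asboolP[j /val_inj ->]//|ci]; apply/asboolP; by exists i.
have Sn j : S j -> (j < n)%N by move=> /asboolP[i <- _]; exact: ltn_ord.
(* Consecutive indices in [S] would be a multiple collision. *)
have S1 j : S j -> ~~ S j.+1.
  move=> /asboolP[i ij ci]; apply/negP => /asboolP[k kj ck].
  apply: (motion_no_multiple motionX t0); exists i, k; split=> //.
  by apply: val_inj => /=; rewrite kj -ij.
have vpreE k : vpre X k t = vpost X k s.
  by have [-> _] := motion_free motionX s0 st free k.
have mext k : 0 < nat_ext m k by exact: m_gt0.
have mc := logconcave_nat_ext m_gt0 m_logconcave.
pose v := nat_ext (fun k => vpost X k s); pose v' := nat_ext (fun k => vpost X k t).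
pose M := nat_ext m.
have coll j : S j -> [/\ v j.+1 < v j,
    v' j = ((M j - M j.+1) * v j + 2 * M j.+1 * v j.+1) / (M j + M j.+1) &
    v' j.+1 = (2 * M j * v j + (M j.+1 - M j) * v j.+1) / (M j + M j.+1)].
  move=> /asboolP[i <- ci]; have := motion_collision motionX t0 ci.
  by rewrite /= /v /v' /M lball_inord rball_inord !vpreE.
have unaff k : (k <= n)%N -> ~~ S k -> ~~ ((0 < k)%N && S k.-1) -> v' k = v k.
  move=> kn Sk Sk1; rewrite /v /v' /nat_ext -vpreE; apply: (motion_unaffected motionX).
    exact: le_lt_trans st.
  move=> i [] /(congr1 val); rewrite /= inordK// => ki /SP Si.
    by rewrite ki Si in Sk.
  by rewrite ki /bump /= Si in Sk1.
have [||rho' [Vrho' card_rho']] := crossed_collide (n := n) (S := S)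
    (V := scaled_vel M v) (V' := scaled_vel M v') Sn S1 _ _ Vrho.
- move=> j Sj; rewrite scaled_velS gtrDl pmulr_llt0 ?subr_lt0 ?invr_gt0.
    by have [] := coll j Sj.
  by apply: (@pair_scale_gt0 _ _ n) => //; rewrite ltnW ?Sn.
- apply: scaled_vel_collide => //.
  + by move=> j /coll[].
  + by move=> j /coll[].
exists rho'; split=> //.
exists (l ++ [seq (t, i) | i <- enum [set i : 'I_n | S i]%SET]); split.
  by rewrite size_cat size_map -cardE; apply: leq_trans card_rho'; rewrite leq_add2r.
move=> [u i] ui /= ut; rewrite mem_cat; have [us|su] := leP u s.
  by rewrite lP.
have [utE|neut] := eqVneq u t.
  rewrite utE in ui *; apply/orP; right; apply/mapP; exists i => //.
  by rewrite mem_enum inE; apply/SP; case: ui.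
case: (free u); first by rewrite su lt_neqAle neut.
by case: ui => /= u0 ci; split => //; exists i.
Qed.

(** Go back from [T] to the last collision time before it, by induction on the length of a list
    containing all earlier collision times. *)
Lemma bounded_by_crossings_ge0 T : 0 <= T -> bounded_by_crossings T.
Proof.
rewrite le_eqVlt => /predU1P[<-|]; first exact: bounded_by_crossings0.
have /finite_seqP[l lE] := motion_locally_finite motionX T.
have : forall u, collision_times r X u -> u < T -> u \in l.
  move=> u cu uT; suff : [set` l] u by [].
  by have [u0 _] := cu; rewrite -lE; split=> //=; rewrite in_itv/= u0 ltW.
(* The list may contain other numbers as well, so it remains usable when [T] is replaced by an
   earlier time. *)
move: {lE}(size l) {-2}l (leqnn (size l)) => k.
elim: k l T => [|k IHk] l0 T l lk lP T0.
  apply: (bounded_by_crossings_step (lexx 0) T0 _ bounded_by_crossings0).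
  move=> u /andP[_ uT] cu; have := lP _ cu uT.
  by move: lk; rewrite leqn0 => /nilP ->.
have [|] := eqVneq [seq u <- l | `[< collision_times r X u >] && (u < T)] [::].
  move=> l00; apply: (bounded_by_crossings_step (lexx 0) T0 _ bounded_by_crossings0).
  move=> u /andP[_ uT] cu.
  have : u \in [seq u <- l | `[< collision_times r X u >] && (u < T)].
    by rewrite mem_filter lP// uT !andbT; apply/asboolP.
  by rewrite l00.
case lE : [seq u <- l | _] => [//|x l'] _.
have [y + ymax] := ex_max_seq x l'.
rewrite -lE mem_filter => /andP[/andP[/asboolP cy yT] yl].
have y0 : 0 <= y by case: cy.
apply: (bounded_by_crossings_step y0 yT).
  move=> u /andP[yu uT] cu; have := ymax u; rewrite -lE mem_filter lP// uT !andbT.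
  by move=> /(_ (asboolT cu)); rewrite leNgt yu.
have [->|yn0] := eqVneq y 0; first exact: bounded_by_crossings0.
apply: (IHk [::] y (rem y l)) => //.
- by rewrite size_rem//; lia.
- move=> u cu uy; have := lP _ cu (lt_trans uy yT).
  by rewrite (perm_mem (perm_to_rem yl)) inE lt_eqF.
- by rewrite lt_neqAle eq_sym yn0.
Qed.

Lemma collisions_le : collisions r X #<= `I_((n * n.+1) %/ 2).
Proof.
apply: card_le_fset => B BX.
have [T T0 TB] : exists2 T : R, 0 <= T & forall p, p \in B -> p.1 <= T.
  have [T Tin Tmax] := ex_max_seq 0 [seq p.1 | p <- enum_fset B].
  exists T; first by apply: Tmax; rewrite mem_head.
  by move=> p pB; apply: Tmax; rewrite inE map_f ?orbT.
have [rho [_ [s [ls sP]]]] := bounded_by_crossings_ge0 T0.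
apply: leq_trans (card_crossed rho); apply: leq_trans ls.
apply: uniq_leq_size; first exact: fset_uniq.
by move=> p pB; apply: sP; [exact: BX|exact: TB].
Qed.
End upper_bound.

(** * Building motions from free flights and collisions *)

Definition gap {R : realType} (f : nat -> R) (j : nat) : R := f j.+1 - f j.

Definition collide {R : realType} (m v : nat -> R) (i k : nat) : R :=
  if k == i then ((m i - m i.+1) * v i + 2 * m i.+1 * v i.+1) / (m i + m i.+1)
  else if k == i.+1 then
    (2 * m i * v i + (m i.+1 - m i) * v i.+1) / (m i + m i.+1)
  else v k.

(* Subtracting [offset r] from the positions turns the balls into point
   particles with the same collisions. *)
Definition offset {R : realType} (r : nat -> R) (k : nat) : R :=
  \sum_(j < k) (r j + r j.+1).

Lemma offsetS {R : realType} (r : nat -> R) k :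
  offset r k.+1 = offset r k + (r k + r k.+1).
Proof. by rewrite /offset big_ord_recr. Qed.

(* A time-0 state: positions [x], velocities [u] just before and [v] just
   after; some pairs may be colliding. *)
Definition colliding_state {R : realType} (m : nat -> R) (n : nat)
    (x u v : nat -> R) : Prop :=
  [/\ forall i, (i < n)%N -> gap x i = 0 ->
        [/\ u i.+1 < u i, v i = collide m u i i & v i.+1 = collide m u i i.+1],
      forall k, (k <= n)%N ->
        (forall i, (i < n)%N -> k = i \/ k = i.+1 -> gap x i <> 0) -> v k = u k &
      forall i, (i.+1 < n)%N -> gap x i = 0 -> gap x i.+1 <> 0].

(** Prescribing [vpre] at time 0 and continuity on all of [R] allows [X] to be glued after an
    earlier flight that ends in a collision. Collisions at time 0 are left out of [s]; they are
    counted with the earlier flight. *)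
Definition motion_from {R : realType} (m r : nat -> R) (n : nat)
    (x u v : nat -> R) (X : trajectory R n) (s : seq (R * 'I_n)) : Prop :=
  [/\ motion (fun k : 'I_n.+1 => m k) (fun k : 'I_n.+1 => r k)
        (fun k : 'I_n.+1 => x k + offset r k) (fun k : 'I_n.+1 => v k) X,
      forall k : 'I_n.+1, vpre X k 0 = u k,
      forall k, continuous (pos X k),
      uniq s &
      forall t i, (t, i) \in s <-> 0 < t /\ contact (fun k : 'I_n.+1 => r k) X t i].

Lemma contact_gap {R : realType} n (r y : nat -> R) (X : trajectory R n) t (i : 'I_n) :
  (forall k : 'I_n.+1, pos X k t = y k + offset r k) ->
  contact (fun k : 'I_n.+1 => r k) X t i <-> gap y i = 0.
Proof.
move=> Xy; rewrite /contact /gap !Xy /= (_ : bump 0 i = i.+1)// offsetS.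
by split; lra.
Qed.

Lemma order_gap {R : realType} n (r y : nat -> R) (X : trajectory R n) t (i : 'I_n) :
  (forall k : 'I_n.+1, pos X k t = y k + offset r k) -> 0 <= gap y i ->
  r (lball i) + r (rball i) <= pos X (rball i) t - pos X (lball i) t.
Proof.
by move=> Xy; rewrite /gap !Xy /= (_ : bump 0 i = i.+1)// offsetS; lra.
Qed.

Lemma free_motion {R : realType} (m r : nat -> R) n (x u v : nat -> R) :
  (forall j, (j < n)%N -> 0 <= gap x j) -> (forall j, (j < n)%N -> 0 <= gap v j) ->
  (forall j, (j < n)%N -> 0 < gap x j \/ 0 < gap v j) ->
  colliding_state m n x u v ->
  exists (X : trajectory R n), motion_from m r x u v X [::].
Proof.
move=> gx gv gxv [st_coll st_free st_mult].
pose X : trajectory R n := Trajectory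
  (fun (k : 'I_n.+1) (t : R) => x k + offset r k + v k * t)
  (fun (k : 'I_n.+1) (t : R) => if t <= 0 then u k else v k)
  (fun (k : 'I_n.+1) (t : R) => v k).
have Xy t (k : 'I_n.+1) : pos X k t = (x k + v k * t) + offset r k by rewrite /=; ring.
have gE j t : gap (fun k => x k + v k * t) j = gap x j + gap v j * t.
  by rewrite /gap; ring.
have cE t (i : 'I_n) : contact (fun k : 'I_n.+1 => r k) X t i <-> gap x i + gap v i * t = 0.
  by rewrite -gE; apply: contact_gap.
have nc t (i : 'I_n) : 0 < t -> ~ contact (fun k : 'I_n.+1 => r k) X t i.
  move=> t0 /cE.
  have := gx i (ltn_ord i); have := gv i (ltn_ord i).
  by case: (gxv i (ltn_ord i)) => ?; nra.
have c0 t (i : 'I_n) : 0 <= t -> contact (fun k : 'I_n.+1 => r k) X t i -> t = 0 /\ gap x i = 0.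
  rewrite le_eqVlt => /predU1P[<-|t0 /(nc _ _ t0)//].
  by move=> /cE; rewrite mulr0 addr0.
have Xcont (k : 'I_n.+1) : continuous (pos X k).

  move=> t; apply: (@cvgD _ R^o R _ _ (cst (x k + offset r k)) (fun w => v k * w)).
    exact: cvg_cst.
  by apply: cvgM; [exact: cvg_cst|exact: cvg_id].
exists X; split => //.
- split => //=.
  + by move=> k /=; rewrite mulr0 addr0.
  + by move=> k; exact: (continuous_subspaceT (Xcont k)).
  + move=> t i t0; apply: (@order_gap _ _ r (fun k => x k + v k * t) X t) => //; rewrite gE.
    by rewrite addr_ge0 ?gx// mulr_ge0 ?gv.
  + move=> T; apply: (@sub_finite_set _ _ [set 0]) => // t [[t0 [i ci]] _].
    by have [->] := c0 _ _ t0 ci.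
  + move=> s t s0 st _ k; rewrite leNgt (le_lt_trans s0 st)/=; split=> // w _.
    by ring.
  + move=> t i t0 /(c0 _ _ t0)[-> gi]; rewrite lexx.
    have [uu -> ->] := st_coll i (ltn_ord i) gi.
    by rewrite /bump /= /collide !eqxx (gtn_eqF (ltnSn i)).
  + by move=> t k t0 _; rewrite leNgt t0.
  + move=> t t0 [i [j [/(congr1 val) /= ji /(c0 _ _ t0)[_ gi] /(c0 _ _ t0)[_ gj]]]].
    apply: (st_mult i) => //; first by rewrite -[i.+1]ji ltn_ord.
    by rewrite -[i.+1]ji.
- by move=> k; rewrite /= lexx.
- by move=> t i; rewrite in_nil; split=> // -[t0 /(nc _ _ t0)].
Qed.

(** Writing the function as [f (min t a) + g (max (t - a) 0) - g 0] avoids a separate study of the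
    point [a]. *)
Lemma continuous_glue {R : realType} (f g : R -> R) (a : R) :
  continuous f -> continuous g -> f a = g 0 ->
  continuous (fun t => if t < a then f t else g (t - a)).
Proof.
move=> cf cg fg.
have -> : (fun t => if t < a then f t else g (t - a)) =
    (fun t => f (Num.min t a) + g (Num.max (t - a) 0) - g 0).
  apply/funext => t; case: ltP => ta.
    by rewrite max_r ?subr_le0 ?(ltW ta)// addrK.
  by rewrite max_l ?subr_ge0// fg addrAC subrr add0r.
move=> t; apply: cvgB; last exact: cvg_cst.
apply: cvgD.
  apply: (@continuous_comp _ _ _ (fun t => Num.min t a) f); last exact: cf.
  by apply: (@continuous_min _ _ (id : R -> R^o) (cst a)); [exact: cvg_id|exact: cvg_cst].
apply: (@continuous_comp _ _ _ (fun t => Num.max (t - a) 0) g); last exact: cg.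
apply: (@continuous_max _ _ (fun t => t - a : R^o) (cst 0)); last exact: cvg_cst.
by apply: cvgB; [exact: cvg_id|exact: cvg_cst].
Qed.

(** [X] flies freely up to [tau] and then follows [Y] delayed by [tau]. The contact of pair [i] at
    time 0 of [Y] becomes the collision [(tau, i)]. *)
Lemma prepend_motion {R : realType} (m r : nat -> R) n (x u v x' v' : nat -> R)
    (tau : R) (i : 'I_n) (Y : trajectory R n) (s : seq (R * 'I_n)) :
  0 < tau -> (forall j, (j < n)%N -> 0 <= gap x j) ->
  (forall k, (k <= n)%N -> x' k = x k + v k * tau) ->
  gap x' i = 0 -> gap v i < 0 ->
  (forall j, (j < n)%N -> j <> i -> 0 < gap x' j) ->
  (forall k, (k <= n)%N -> v' k = collide m v i k) ->
  colliding_state m n x u v ->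
  motion_from m r x' v v' Y s ->
  exists X : trajectory R n, motion_from m r x u v X
    ((tau, i) :: [seq (p.1 + tau, p.2) | p <- s]).
Proof.
move=> tau0 gx x'E gx'i gvi gx' v'E [st_coll st_free st_mult] [motY preY contY us sP].
pose X : trajectory R n := Trajectory
  (fun (k : 'I_n.+1) (t : R) => if t < tau then x k + offset r k + v k * t else pos Y k (t - tau))
  (fun (k : 'I_n.+1) (t : R) => if t <= 0 then u k else if t < tau then v k else vpre Y k (t - tau))
  (fun (k : 'I_n.+1) (t : R) => if t < tau then v k else vpost Y k (t - tau)).
pose rI (k : 'I_n.+1) := r k.
have XL t (k : 'I_n.+1) : t < tau -> pos X k t = (x k + v k * t) + offset r k.
  by rewrite /= => ->; ring.
have XR t (k : 'I_n.+1) : tau <= t -> pos X k t = pos Y k (t - tau).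
  by rewrite /= ltNge => ->.
have leqn (k : 'I_n.+1) : (k <= n)%N by rewrite -ltnS.
have Y0 (k : 'I_n.+1) : pos Y k 0 = x k + offset r k + v k * tau.
  by rewrite (motion_pos0 motY) x'E//; ring.
have gE j t : gap (fun k => x k + v k * t) j = gap x j + gap v j * t.
  by rewrite /gap; ring.
have gx'E j : (j < n)%N -> gap x' j = gap x j + gap v j * tau.
  by move=> jn; rewrite -gE /gap !x'E// ltnW.
(* Each gap is affine in time. That of [i] decreases to 0 at [tau]; any other is nonnegative at 0
   and positive at [tau]. *)
have gpos t j : (j < n)%N -> 0 < t < tau -> 0 < gap x j + gap v j * t.
  move=> jn /andP[t0 tt]; have := gx j jn; have := gx'E j jn.
  have [->|/eqP ji] := eqVneq j i.
    rewrite gx'i => e _; have -> : gap x i + gap v i * t = - gap v i * (tau - t) by lra.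
    by rewrite mulr_gt0 ?oppr_gt0 ?subr_gt0.
  move=> e g0; have g'0 := gx' j jn ji.
  rewrite -(pmulr_rgt0 _ tau0).
  have -> : tau * (gap x j + gap v j * t) = gap x j * (tau - t) + gap x' j * t.
    by rewrite e; ring.
  by rewrite ltr_wpDl ?mulr_gt0// mulr_ge0// subr_ge0 ltW.
have cL t (j : 'I_n) : t < tau ->
    contact rI X t j <-> gap x j + gap v j * t = 0.
  by move=> tt; rewrite -gE; apply: contact_gap => k; exact: XL.
have cR t (j : 'I_n) : tau <= t -> contact rI X t j <-> contact rI Y (t - tau) j.
  by move=> tt; rewrite /contact !XR.
have cY0 (j : 'I_n) : contact rI Y 0 j <-> j = i.
  have -> : contact rI Y 0 j <-> gap x' j = 0.
    by apply: contact_gap => k; exact: (motion_pos0 motY).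
  split=> [gj|->//]; apply: val_inj; apply/eqP/negPn/negP => /eqP ji.
  by have := gx' j (ltn_ord j) ji; rewrite gj ltxx.
have ncL t (j : 'I_n) : 0 < t -> t < tau -> ~ contact rI X t j.
  move=> t0 tt /(cL _ _ tt) g0.
  by have := gpos t j (ltn_ord j); rewrite t0 tt g0 ltxx => /(_ isT).
have c0 (j : 'I_n) : contact rI X 0 j <-> gap x j = 0.
  by rewrite cL// mulr0 addr0.
have ctau : contact rI X tau i by apply/cR => //; rewrite subrr; apply/cY0.
have Xcont (k : 'I_n.+1) : continuous (pos X k).
  apply: (@continuous_glue _ (fun t => x k + offset r k + v k * t)) => //.
  move=> t; apply: (@cvgD _ R^o R _ _ (cst (x k + offset r k)) (fun w => v k * w)).
    exact: cvg_cst.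
  by apply: cvgM; [exact: cvg_cst|exact: cvg_id].
have ctimes t : tau <= t -> collision_times rI Y (t - tau) <-> collision_times rI X t.
  move=> tt; split=> -[_ [j cj]]; (split; last by exists j; apply/cR).
    by rewrite (le_trans (ltW tau0)).
  by rewrite subr_ge0.
exists X; split => //.
- split.
  + by move=> k; rewrite XL// mulr0 addr0.
  + by move=> k; rewrite /= tau0.
  + by move=> k; exact: (continuous_subspaceT (Xcont k)).
  + move=> t j t0; have [tt|tt] := ltP t tau.
      apply: (@order_gap _ _ r (fun k => x k + v k * t) X t) => [k|]; first exact: XL.
      move: t0; rewrite gE le_eqVlt => /predU1P[<-|t0]; first by rewrite mulr0 addr0 gx.
      by rewrite ltW// gpos// t0.
    by rewrite !XR//; apply: (motion_order motY); rewrite subr_ge0.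
  + move=> T; apply: (@sub_finite_set _ _ ([set 0] `|` ((fun t => t + tau) @`
        (collision_times rI Y `&` `[0, T])))); last first.
      rewrite finite_setU; split=> //.
      by apply: finite_image; exact: (motion_locally_finite motY).
    move=> t /= [ct]; rewrite in_itv/= => /andP[t0 tT].
    have [tt|tt] := ltP t tau.
      left; move: t0 ct; rewrite le_eqVlt => /predU1P[<-//|t0] [_ [j]].
      by move=> /(ncL _ _ t0 tt).
    right; exists (t - tau); last by rewrite subrK.
    split; first exact/ctimes.
    by rewrite /= in_itv/= subr_ge0 tt /=; lra.
  + move=> w t w0 wt nc k; have t0 := le_lt_trans w0 wt.
    have [tw|wtau] := leP tau w.
      have tt : tau <= t by rewrite (le_trans tw)// ltW.
      have w0' : 0 <= w - tau by rewrite subr_ge0.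
      have wt' : w - tau < t - tau by rewrite ltrD2r.
      have ncY z : w - tau < z < t - tau -> ~ collision_times rI Y z.
        move=> /andP[wz zt]; have ztau : tau <= z + tau.
          by rewrite lerDr; apply: ltW; apply: le_lt_trans wz.
        have := nc (z + tau); rewrite -ltrBlDr wz -ltrBrDr zt => /(_ isT) h.
        by have := ctimes _ ztau; rewrite addrK => h1 /h1.
      have [e1 e2] := motion_free motY w0' wt' ncY k.
      rewrite /= leNgt t0 ltNge tt ltNge tw; split=> // z /andP[wz zt] /=.
      rewrite ltNge (le_trans tw wz) /= e2; last by rewrite !lerD2r wz.
      by congr (_ + _ * _); ring.
    (* The interval cannot straddle [tau], which is itself a collision time. *)
    have ttau : t <= tau.
      rewrite leNgt; apply/negP => tt; apply: (nc tau); first by rewrite wtau.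
      by split; [exact: ltW|exists i].
    rewrite [vpost _ _ _]/= wtau; split.
      rewrite /= leNgt t0 /=; case: ltP => // tt.
      by rewrite (_ : t = tau) ?subrr ?preY//; apply/eqP; rewrite eq_le ttau.
    move=> z /andP[wz zt]; rewrite [in RHS]XL//; have [ztau|ztau] := ltP z tau.
      by rewrite XL//; ring.
    have -> : z = tau by apply/eqP; rewrite eq_le ztau (le_trans zt).
    by rewrite XR// subrr Y0; ring.
  + move=> t j t0 cj; have [tt|tt] := ltP t tau.
      move: t0 cj; rewrite le_eqVlt => /predU1P[<-|t0 /(ncL _ _ t0 tt)//].
      move=> /c0 gj; have [uu va vb] := st_coll j (ltn_ord j) gj.
      rewrite /= lexx tau0 (_ : bump 0 j = j.+1)// va vb /collide !eqxx.
      by rewrite (gtn_eqF (ltnSn j)).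
    have tp : (t <= 0) = false by apply/negbTE; rewrite -ltNge (lt_le_trans tau0).
    have tt' : 0 <= t - tau by rewrite subr_ge0.
    have := motion_collision motY tt' (proj1 (cR _ _ tt) cj).
    by rewrite /= tp (le_gtF tt).
  + move=> t k t0 nk; rewrite /= leNgt t0 /=; case: ltP => // tt.
    (* At [tau] the clock of [Y] shows 0, where [motion_unaffected] is silent; the formula for [v']
       is used instead. *)
    move: tt nk; rewrite le_eqVlt => /predU1P[<-|tt] nk.
      rewrite subrr preY (motion_vel0 motY) v'E// /collide.
      have [ki|_] := eqVneq (k : nat) i.
        by case: (nk i) => //; left; apply: val_inj.
      have [ki|//] := eqVneq (k : nat) i.+1.
      by case: (nk i) => //; right; apply: val_inj.
    apply: (motion_unaffected motY); first by rewrite subr_gt0.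
    by move=> j /nk h /(cR _ _ (ltW tt)).
  + move=> t t0 [j [l [lj cj cl]]]; have [tt|tt] := ltP t tau.
      move: t0 cj cl; rewrite le_eqVlt => /predU1P[<-|t0 /(ncL _ _ t0 tt)//].
      move=> /c0 gj /c0 gl; move: lj => /(congr1 val) /= lj.
      by apply: (st_mult j) => //; rewrite -[j.+1]lj.
    apply: (@motion_no_multiple _ _ _ _ _ _ _ motY (t - tau)); first by rewrite subr_ge0.
    by exists j, l; split=> //; apply/cR.
- by move=> k; rewrite /= lexx.
- rewrite /= map_inj_uniq ?us ?andbT//; last first.
    by move=> [a b] [c d] [/addIr -> ->].
  apply/mapP => -[[a b] ab [ta _]]; move: ab => /sP[a0 _].
  by move: a0; rewrite -(ltrD2r tau) add0r /= -ta ltxx.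
- move=> t j; rewrite inE; split.
    move=> /predU1P[[-> ->]//|/mapP[[a b] /sP[a0 cb] [-> ->]]] /=.
    have atau : tau <= a + tau by rewrite lerDr ltW.
    by split; [rewrite addr_gt0|apply/cR => //; rewrite addrK].
  move=> [t0 cj]; have [tt|tt] := ltP t tau; first by have := ncL _ _ t0 tt cj.
  move: tt cj; rewrite le_eqVlt => /predU1P[<-|tt].
    by move=> /cR; rewrite subrr => /(_ (lexx _))/cY0 ->; rewrite eqxx.
  move=> /(cR _ _ (ltW tt)) cj; apply/orP; right; apply/mapP; exists (t - tau, j).
    by apply/sP; rewrite subr_gt0.
  by rewrite /= subrK.
Qed.

(** * Collision sequences as an inductive predicate *)

(* [run m n x v K]: free flight from positions [x] with velocities [v] meets
   exactly [K] collisions, one at a time and at positive times. *)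
Inductive run {R : realType} (m : nat -> R) (n : nat) :
    (nat -> R) -> (nat -> R) -> nat -> Prop :=
| run_free x v :
    (forall j, (j < n)%N -> 0 <= gap x j) ->
    (forall j, (j < n)%N -> 0 <= gap v j) ->
    (forall j, (j < n)%N -> 0 < gap x j \/ 0 < gap v j) ->
    run m n x v 0
| run_collide x v x' v' tau i K :
    0 < tau -> (i < n)%N ->
    (forall j, (j < n)%N -> 0 <= gap x j) ->
    (forall k, (k <= n)%N -> x' k = x k + v k * tau) ->
    gap x' i = 0 -> gap v i < 0 ->
    (forall j, (j < n)%N -> j <> i -> 0 < gap x' j) ->
    (forall k, (k <= n)%N -> v' k = collide m v i k) ->
    run m n x' v' K -> run m n x v K.+1.

Lemma collide_colliding_state {R : realType} (m : nat -> R) n (x v v' : nat -> R) i :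
  (i < n)%N -> gap x i = 0 -> gap v i < 0 ->
  (forall j, (j < n)%N -> j <> i -> 0 < gap x j) ->
  (forall k, (k <= n)%N -> v' k = collide m v i k) ->
  colliding_state m n x v v'.
Proof.
move=> iln gi vi gx v'E.
have gx0 j : (j < n)%N -> gap x j = 0 -> j = i.
  move=> jn gj; apply/eqP/negPn/negP => /eqP ji.
  by have := gx j jn ji; rewrite gj ltxx.
split.
- move=> j jn /(gx0 _ jn) ->; rewrite !v'E//; last exact: ltnW.
  by split=> //; rewrite -subr_lt0.
- move=> k kn nk; rewrite v'E// /collide.
  have [ki|_] := eqVneq k i; first by case: (nk i) => //; left.
  by have [ki|//] := eqVneq k i.+1; case: (nk i) => //; right.
- by move=> j jn /(gx0 _ (ltnW jn)) ji /(gx0 _ jn); lia.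
Qed.

(** Quantifying over [u] lets the induction restart at a collision, where the velocities before and
    after differ. *)
Lemma run_motion {R : realType} (m r : nat -> R) n (x v : nat -> R) K :
  run m n x v K -> forall u, colliding_state m n x u v ->
  exists (X : trajectory R n) (s : seq (R * 'I_n)),
    motion_from m r x u v X s /\ size s = K.
Proof.
elim=> {x v K} [x v gx gv gxv|x v x' v' tau i K tau0 iln gx x'E gi vi gx' v'E _ IH] u st.
  by have [X ?] := @free_motion _ m r n x u v gx gv gxv st; exists X, [::].
have [Y [s [mY <-]]] := IH _ (collide_colliding_state iln gi vi gx' v'E).
have [X mX] := @prepend_motion _ m r n x u v x' v' tau (Ordinal iln) Y s tau0
  gx x'E gi vi gx' v'E st mY.
by exists X, ((tau, Ordinal iln) :: [seq (p.1 + tau, p.2) | p <- s]); rewrite /= size_map.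
Qed.

(** * The chain of collisions started by a fast ball *)

Lemma gap_collide {R : realType} (m v : nat -> R) i :
  0 < m i -> 0 < m i.+1 -> gap (collide m v i) i = - gap v i.
Proof.
move=> m0 m1; rewrite /gap /collide !eqxx (gtn_eqF (ltnSn i)).
by field; lra.
Qed.

Lemma gap_collide_right {R : realType} (m v : nat -> R) i :
  0 < m i -> 0 < m i.+1 ->
  gap (collide m v i) i.+1 = gap v i.+1 + gap v i * (2 * m i / (m i + m i.+1)).
Proof.
move=> m0 m1; rewrite /gap /collide !eqxx (gtn_eqF (ltnSn i)).
by rewrite (gtn_eqF (ltnSn i.+1)) (gtn_eqF (ltnW (ltnSn i.+1))); field; lra.
Qed.

Lemma gap_collide_left {R : realType} (m v : nat -> R) i :
  0 < m i.+1 -> 0 < m i.+2 ->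
  gap (collide m v i.+1) i =
    gap v i + gap v i.+1 * (2 * m i.+2 / (m i.+1 + m i.+2)).
Proof.
move=> m0 m1; rewrite /gap /collide !eqxx (ltn_eqF (ltnSn i)).
by rewrite (ltn_eqF (ltnW (ltnSn i.+1))); field; lra.
Qed.

Lemma gap_collide_far {R : realType} (m v : nat -> R) i j :
  (i.+1 < j)%N -> gap (collide m v i) j = gap v j.
Proof.
by move=> ij; rewrite /gap /collide !gtn_eqF//; lia.
Qed.

(** Only pair [k] approaches, so it meets first, and no other gap shrinks meanwhile. The
    continuation is asked for every [x'] because only the signs of the gaps matter afterwards. *)
Lemma run_first_collision {R : realType} (m : nat -> R) n k (x v : nat -> R) K :
  (k < n)%N -> (forall j, (j < n)%N -> 0 <= gap x j) ->
  0 < gap x k -> gap v k < 0 ->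
  (forall j, (j < n)%N -> j <> k -> 0 <= gap v j) ->
  (forall j, (j < n)%N -> j <> k -> 0 < gap x j \/ 0 < gap v j) ->
  (forall x', (forall j, (j < n)%N -> j <> k -> 0 < gap x' j) -> gap x' k = 0 ->
     run m n x' (collide m v k) K) ->
  run m n x v K.+1.
Proof.
move=> kn gx gxk gvk gv gxv next; pose tau := gap x k / - gap v k.
have tau0 : 0 < tau by rewrite divr_gt0// oppr_gt0.
have gE j : gap (fun k => x k + v k * tau) j = gap x j + gap v j * tau.
  by rewrite /gap; ring.
have gk : gap (fun k => x k + v k * tau) k = 0.
  by rewrite gE /tau; field; lra.
have gj j : (j < n)%N -> j <> k -> 0 < gap (fun k => x k + v k * tau) j.
  move=> jn jk; rewrite gE; have := gx j jn; have := gv j jn jk.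
  case: (gxv j jn jk) => ? ? ?; first by rewrite ltr_pwDl// mulr_ge0// ltW.
  by rewrite ltr_wpDl// mulr_gt0.
exact: (run_collide tau0 kn gx (fun _ _ => erefl) gk gvk gj (fun _ _ => erefl) (next _ gj gk)).
Qed.

(* A fast ball comes from the right into a system that no longer collides: the
   blow is passed on through the pairs [k], [k - 1], ..., [0].  The last
   hypothesis says that after its collision with [k] ball [k.+1] does not
   approach ball [k.+2]; log-concavity propagates it along the chain. *)
Lemma chain_run {R : realType} (m : nat -> R) n :
  (forall k, (k <= n)%N -> 0 < m k) ->
  (forall j, (j.+2 <= n)%N ->
     4 * (m j * m j.+2) <= (m j + m j.+1) * (m j.+1 + m j.+2)) ->
  forall k (w : nat -> R), (k < n)%N -> (forall j, (j < k)%N -> 0 <= gap w j) ->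
  exists L, forall x v : nat -> R, (forall j, (j <= k)%N -> v j = w j) ->
    v k.+1 < L ->
    (forall j, (j < n)%N -> 0 <= gap x j) -> 0 < gap x k ->
    (forall j, (k < j < n)%N -> 0 <= gap v j) ->
    (forall j, (j < n)%N -> j <> k -> 0 < gap x j \/ 0 < gap v j) ->
    ((k.+1 < n)%N -> 0 <= gap v k.+1 + gap v k * (2 * m k / (m k + m k.+1))) ->
    run m n x v k.+1.
Proof.
move=> m0 mc.
(* Once pair [k] has collided, neither it nor any pair to its right approaches. *)
have after k (v : nat -> R) : (k < n)%N -> gap v k < 0 ->
    (forall j, (k < j < n)%N -> 0 <= gap v j) ->
    ((k.+1 < n)%N -> 0 <= gap v k.+1 + gap v k * (2 * m k / (m k + m k.+1))) ->
    forall j, (k <= j < n)%N -> 0 <= gap (collide m v k) j.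
  move=> kn vk gv vk1 j; have mk := m0 k (ltnW kn); have mk1 := m0 k.+1 kn.
  move=> /andP[]; rewrite leq_eqVlt => /predU1P[<- _|].
    by rewrite gap_collide// oppr_ge0 ltW.
  rewrite leq_eqVlt => /predU1P[<- jn|kj jn].
    by rewrite gap_collide_right// vk1.
  by rewrite gap_collide_far// gv// jn ltnW.
elim=> [|k IHk] w kn gw.
  exists (w 0%N) => x v vw v1 gx gx0 gv gxv gv1.
  have gv0 : gap v 0 < 0 by rewrite /gap subr_lt0 (vw 0%N).
  apply: (run_first_collision kn) => //.
    by move=> j jn j0; apply: gv; lia.
  move=> x' gx' gx'0.
  have [m00 m01] : 0 < m 0%N /\ 0 < m 1%N by split; apply: m0; lia.
  apply: run_free => j jn.
  - by have [->|/eqP j0] := eqVneq j 0%N; rewrite ?gx'0// ltW ?gx'.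
  - exact: after.
  - have [->|/eqP j0] := eqVneq j 0%N; last by left; apply: gx'.
    by right; rewrite gap_collide ?oppr_gt0.
have m_k := m0 k ltac:(lia); have m_k1 := m0 k.+1 ltac:(lia); have m_k2 := m0 k.+2 kn.
have [L0 IH] := IHk w (ltnW kn) (fun j jk => gw j (ltnW jk)).
(* [v k.+2 < L1] says that ball [k.+1] leaves its collision with velocity below [L0], as the next
   link requires; the minimum with [w k.+1] makes pair [k.+1] approach. *)
pose L1 := (L0 * (m k.+1 + m k.+2) - (m k.+1 - m k.+2) * w k.+1) / (2 * m k.+2).
exists (Num.min L1 (w k.+1)) => x v vw; rewrite lt_min => /andP[vL1 vwk] gx gxk gv gxv gv1.
have gvk : gap v k.+1 < 0 by rewrite /gap subr_lt0 (vw k.+1).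
have gvlt j : (j < k.+1)%N -> 0 <= gap v j.
  by move=> jk; rewrite /gap !vw//; [exact: gw|lia].
apply: (run_first_collision kn) => //.
  move=> j jn jk; have [jlt|jge] := ltnP j k.+1; first exact: gvlt.
  by apply: gv; lia.
move=> x' gx' gx'0; apply: IH.
- by move=> j jk; rewrite /collide !ltn_eqF ?vw//; lia.
- rewrite /collide eqxx vw// ltr_pdivrMr ?addr_gt0//.
  by move: vL1; rewrite ltr_pdivlMr ?mulr_gt0//; lra.
- move=> j jn; have [->|/eqP jk] := eqVneq j k.+1; first by rewrite gx'0.
  by rewrite ltW ?gx'.
- by apply: gx'; lia.
- by move=> j jk; apply: after.
- move=> j jn jk; have [->|/eqP jk1] := eqVneq j k.+1; last by left; apply: gx'.
  by right; rewrite gap_collide ?oppr_gt0.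
(* The hypothesis for the next link is a sum of two nonnegative terms, the second one by [mc]. *)
- move=> _; rewrite gap_collide// gap_collide_left// mulrDl addrA.
  have -> : - gap v k.+1 + gap v k * (2 * m k / (m k + m k.+1)) +
    gap v k.+1 * (2 * m k.+2 / (m k.+1 + m k.+2)) * (2 * m k / (m k + m k.+1)) =
    gap v k * (2 * m k / (m k + m k.+1)) + - gap v k.+1 *
      (1 - 4 * (m k * m k.+2) / ((m k + m k.+1) * (m k.+1 + m k.+2))).
    by field; apply/andP; split; lra.
  rewrite addr_ge0// mulr_ge0//.
  + exact: gvlt.
  + by rewrite divr_ge0 ?mulr_ge0 ?addr_ge0 ?ltW.
  + by rewrite oppr_ge0 ltW.
  + by rewrite subr_ge0 ler_pdivrMr ?mulr_gt0 ?addr_gt0// mul1r mc.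
Qed.

(** * Adding a distant ball, and the extremal motion *)

(** The threshold [L] depends only on the final velocities of the given run. The distance [D] is
    chosen after [V], since a faster ball must start farther away to arrive after the last of the
    [K] collisions. *)
Lemma run_add_ball {R : realType} (m : nat -> R) n (x v : nat -> R) K :
  (forall k, (k <= n.+1)%N -> 0 < m k) ->
  (forall j, (j.+2 <= n.+1)%N ->
     4 * (m j * m j.+2) <= (m j + m j.+1) * (m j.+1 + m j.+2)) ->
  run m n x v K ->
  exists L, forall V, V < L -> exists D, forall y z : nat -> R,
    (forall k, (k <= n)%N -> y k = x k) -> (forall k, (k <= n)%N -> z k = v k) ->
    D < y n.+1 -> z n.+1 = V -> run m n.+1 y z (K + n.+1).
Proof.
move=> m0 mc.
elim=> {x v K} [x v gx gv gxv|x v x' v' tau i K tau0 iln gx x'E gi vi gx' v'E _ [L IH]].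
  have [L chain] := chain_run m0 mc (ltnSn n) gv.
  exists L => V VL; exists (x n) => y z yx zv yn zn.
  have gyx j : (j < n)%N -> gap y j = gap x j by move=> jn; rewrite /gap !yx// ltnW.
  have gzv j : (j < n)%N -> gap z j = gap v j by move=> jn; rewrite /gap !zv// ltnW.
  have gyn : 0 < gap y n by rewrite /gap subr_gt0 yx.
  have jlt j : (j < n.+1)%N -> j <> n -> (j < n)%N by lia.
  rewrite add0n; apply: chain => //.
  - by rewrite zn.
  - move=> j jn; have [->|/eqP j_n] := eqVneq j n; first exact: ltW.
    by rewrite gyx ?gx ?jlt.
  - by move=> j; lia.
  - by move=> j jn j_n; rewrite gyx ?gzv ?jlt//; apply: gxv; apply: jlt.
  - by rewrite ltnn.
exists L => V /IH[D {}IH].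
(* The new ball starts to the right of ball [n], and at time [tau] it is still beyond both [x' n]
   and the distance needed for the rest of the run. *)
exists (Num.max (x n) (Num.max D (x' n) - V * tau)) => y z yx zv.
rewrite gt_max ltrBlDr gt_max => /andP[yn /andP[yD yx']] zn.
have gyx j : (j < n)%N -> gap y j = gap x j by move=> jn; rewrite /gap !yx// ltnW.
have gzv j : (j < n)%N -> gap z j = gap v j by move=> jn; rewrite /gap !zv// ltnW.
have jlt j : (j < n.+1)%N -> j <> n -> (j < n)%N by lia.
pose y' k := y k + z k * tau.
have y'x k : (k <= n)%N -> y' k = x' k by move=> kn; rewrite /y' yx// zv// x'E.
have gy'x j : (j < n)%N -> gap y' j = gap x' j by move=> jn; rewrite /gap !y'x// ltnW.
rewrite addSn; apply: (@run_collide _ _ _ _ _ y' (collide m z i) tau i) => //.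
- exact: ltnW.
- move=> j jn; have [->|/eqP j_n] := eqVneq j n; last by rewrite gyx ?gx ?jlt.
  by rewrite /gap subr_ge0 yx// ltW.
- by rewrite gy'x.
- by rewrite gzv.
- move=> j jn ji; have [->|/eqP j_n] := eqVneq j n; last by rewrite gy'x ?gx' ?jlt.
  by rewrite /gap subr_gt0 y'x// /y' zn.
- apply: IH => //.
  + by move=> k kn; rewrite v'E// /collide !zv// ltnW.
  + by rewrite /y' zn.
  + by rewrite /collide !gtn_eqF// ltnS ltnW.
Qed.

Lemma ex_run {R : realType} (m : nat -> R) n :
  (forall k, (k <= n)%N -> 0 < m k) ->
  (forall j, (j.+2 <= n)%N ->
     4 * (m j * m j.+2) <= (m j + m j.+1) * (m j.+1 + m j.+2)) ->
  exists x v, (forall j, (j < n)%N -> 0 < gap x j) /\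
    run m n x v ((n * n.+1) %/ 2).
Proof.
elim: n => [|n IHn] m0 mc.
  by exists (fun=> 0), (fun=> 0); split=> //; exact: run_free.
have [x [v [gx rxv]]] := IHn (fun k kn => m0 k (leqW kn)) (fun j jn => mc j (leqW jn)).
have [L ext] := run_add_ball m0 mc rxv.
have [D {}ext] := ext (L - 1) ltac:(lra).
pose y k := if k == n.+1 then Num.max D (x n) + 1 else x k.
pose z k := if k == n.+1 then L - 1 else v k.
have yx k : (k <= n)%N -> y k = x k by move=> kn; rewrite /y ltn_eqF.
have yn : y n.+1 = Num.max D (x n) + 1 by rewrite /y eqxx.
exists y, z; split.
  move=> j; rewrite ltnS leq_eqVlt => /predU1P[->|jn].
    rewrite /gap subr_gt0 yn yx//.
    by rewrite ltr_pwDr// le_max lexx orbT.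
  by rewrite /gap !yx// ?(ltnW jn)//; exact: gx.
have -> : ((n.+1 * n.+2) %/ 2 = (n * n.+1) %/ 2 + n.+1)%N.
  by rewrite (_ : n.+1 * n.+2 = n.+1 * 2 + n * n.+1)%N ?divnMDl//; lia.
apply: ext => //.
- by move=> k kn; rewrite /z ltn_eqF.
- by rewrite yn ltr_pwDr// le_max lexx.
- by rewrite /z eqxx.
Qed.

Lemma exists_maximal_motion {R : realType} n (m r : nat -> R) :
  (forall k, (k <= n)%N -> 0 < m k) ->
  (forall j, (j.+2 <= n)%N ->
     4 * (m j * m j.+2) <= (m j + m j.+1) * (m j.+1 + m j.+2)) ->
  exists (x0 v0 : 'I_n.+1 -> R) (X : trajectory R n),
    [/\ initial_positions (fun k : 'I_n.+1 => r k) x0,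
        motion (fun k : 'I_n.+1 => m k) (fun k : 'I_n.+1 => r k) x0 v0 X &
        collisions (fun k : 'I_n.+1 => r k) X #= `I_((n * n.+1) %/ 2)].
Proof.
move=> m0 mc; have [x [v [gx /run_motion rX]]] := ex_run m0 mc.
(* No pair is in contact at time 0, so equal velocities before and after are consistent, and [s]
   lists all collisions. *)
have st : colliding_state m n x v v.
  by split=> // i iln gi; have := gx i ltac:(lia); rewrite gi ltxx.
have [X [s [[motX _ _ us sP] <-]]] := rX r v st.
have apart : initial_positions (fun k : 'I_n.+1 => r k)
    (fun k : 'I_n.+1 => x k + offset r k).
  move=> i; have := gx i (ltn_ord i).
  by rewrite /gap /= (_ : bump 0 i = i.+1)// offsetS; lra.
exists (fun k => x k + offset r k), (fun k => v k), X; split => //.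
have -> : collisions (fun k : 'I_n.+1 => r k) X = [set` s].
  apply/seteqP; split=> -[t i] /=.
    move=> [/= + ci]; rewrite le_eqVlt => /predU1P[t0|t0]; last exact/sP.
    by case: (no_contact0 apart motX (i := i)); rewrite t0.
  by move=> /sP[t0 ci]; split => //=; exact: ltW.
have -> : [set` s] = [set` [fset p | p in s]%fset].
  by apply/seteqP; split=> p /=; rewrite !inE.
by apply/card_eq_fsetP; rewrite card_fseq undup_id.
Qed.

Theorem mainTheorem1 (R : realType) (n : nat) (m r : 'I_n.+1 -> R)
  (n_ge1 : (1 <= n)%N)
  (m_gt0 : forall k, 0 < m k)
  (r_ge0 : forall k, 0 <= r k)
  (m_logconcave : forall h i j : 'I_n.+1,
     i = h.+1 :> nat -> j = i.+1 :> nat -> Num.sqrt (m h * m j) <= m i) :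
  (forall x0 v0 : 'I_n.+1 -> R, admissible m r x0 v0 ->
     forall X : trajectory R n, motion m r x0 v0 X ->
       collisions r X #<= `I_((n * n.+1) %/ 2)) /\
  (exists x0 v0 : 'I_n.+1 -> R, admissible m r x0 v0 /\
     exists X : trajectory R n, motion m r x0 v0 X /\
       collisions r X #= `I_((n * n.+1) %/ 2)).
move=> {r_ge0}.
have m0 k : (k <= n)%N -> 0 < nat_ext m k by move=> _; exact: m_gt0.
split=> [x0 v0 [apart _] X motX|].
  exact: (collisions_le m_gt0 m_logconcave apart motX).
have [x0 [v0 [X []]]] := exists_maximal_motion (nat_ext r) m0
  (logconcave_nat_ext m_gt0 m_logconcave).
have ext (f : 'I_n.+1 -> R) : (fun k : 'I_n.+1 => nat_ext f k) = f.
  by apply/funext => k; exact: nat_ext_val.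
rewrite !ext => apart motX cX; exists x0, v0.
by split; [split=> //; exists X|exists X].
Qed.
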